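(* Let $0<\delta<\frac13$ and let $\mathfrak{G}$ be a family of profinite groups which is uniformly PMSG with constant $E'>0$, i.e. for every $G\in\mathfrak{G}$ and every $N\in\mathbb{N}$, $m_N(G)\le N^{E'\cdot\mathrm{rank}(G)}$. Then there exists a constant $C=C(E',\delta)$, depending only on $E'$ and $\delta$, such that every $G\in\mathfrak{G}$ has a (multi-)subset $A$ of size $|A|\le C\cdot\mathrm{rank}(G)$ with $\delta(A;G)\ge\delta$.
   Context: For a profinite group $G$, $\mathrm{rank}(G)$ denotes the topological rank: the size of a smallest set generating a dense subgroup of $G$ (assumed finite). $m_N(G)$ is the number of maximal open subgroups of index $N$ in $G$. PMSG stands for polynomial maximal subgroup growth. A multi-subset of $G$ is a finite unordered collection of elements of $G$, possibly with repetitions; sizes are counted with multiplicity, and $A\cap H$ is the multi-set of elements of $A$ lying in $H$. For profinite $G$ the detection probability is $\delta(A;G)=\inf\{1-\frac{|A\cap H|}{|A|}: H\}$, where $H$ runs over proper closed subgroups of $G$ (equivalently, over proper open subgroups); thus $\delta(A;G)\ge\delta$ means $|A\cap H|\le(1-\delta)|A|$ for every proper closed subgroup $H$. *)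

(* Defs.v *)
From HB Require Import structures.
From mathcomp Require Import all_boot all_order all_algebra.
From mathcomp Require Import finmap multiset.
From mathcomp Require Import all_classical all_reals all_analysis.

Set Implicit Arguments.
Unset Strict Implicit.
Unset Printing Implicit Defensive.

Import Order.TTheory GRing.Theory Num.Theory.

Local Open Scope mset_scope.
Local Open Scope classical_set_scope.
Local Open Scope ring_scope.

HB.mixin Record isProfiniteGroup G of Group G & Topological G := {
  profinite_mulg_continuous : continuous (fun p : G * G => (p.1 * p.2)%g) ;
  profinite_invg_continuous : continuous (fun x : G => (x^-1)%g) ;
  profinite_compact : compact [set: G] ;
  profinite_hausdorff : hausdorff_space G ;
  profinite_totally_disconnected : totally_disconnected [set: G]
}.

#[short(type="profiniteGroupType")]
HB.structure Definition ProfiniteGroup :=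
  { G of isProfiniteGroup G & Group G & Topological G }.

Section ProfiniteGroupTheory.
Variable G : profiniteGroupType.
Implicit Types (H K M S : set G) (n N : nat).

Definition subgroup H := group_closed [in H].

(* abstract (not topological) generation *)
Definition generated_subgroup S : set G := smallest subgroup S.

Definition topologically_generates S := dense (generated_subgroup S).

Definition generated_by_card n :=
  exists S, (S #= `I_n)%card /\ topologically_generates S.

Definition topologically_finitely_generated :=
  exists n, generated_by_card n.

(* Only meaningful when G is topologically finitely generated; the value is
   the junk 0 otherwise. *)
Definition rank : nat :=
  xget 0%N [set n | generated_by_card n /\
                    forall m, generated_by_card m -> (n <= m)%N].

Definition left_cosets H : set (set G) :=
  [set [set (x * h)%g | h in H] | x in [set: G]].

Definition has_index H N := (left_cosets H #= `I_N)%card.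

Definition maximal_subgroup M :=
  [/\ subgroup M, M <> setT &
      forall K, subgroup K -> M `<=` K -> K = M \/ K = setT].

Definition maximal_open_subgroup M := maximal_subgroup M /\ open M.

Definition proper_closed_subgroup H :=
  [/\ subgroup H, closed H & H <> setT].

(* Extended-real valued: +oo if there are infinitely many such subgroups. *)
Definition num_maximal_open (R : realType) N : \bar R :=
  counting [set M | maximal_open_subgroup M /\ has_index M N].

(* For A empty every quotient is 0 / 0 = 0, so the value is not meaningful
   unless G is trivial; for G trivial the infimum is over the empty set and
   equals +oo. *)
Definition detection_prob (R : realType) (A : {mset G}) : \bar R :=
  ereal_inf [set (1 - (count [in H] A)%:R / (size A)%:R : R)%:E |
             H in proper_closed_subgroup].

End ProfiniteGroupTheory.

Definition uniformly_PMSG (R : realType) (E' : R)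
    (fam : set profiniteGroupType) :=
  forall G, fam G -> forall N : nat,
    (num_maximal_open G R N <= (N%:R `^ (E' * (rank G)%:R))%:E)%E.

(* Main.v *)
(* Choose n = 15 k elements uniformly at random, where k is a large multiple of
   the rank d. If X is the number of them lying in a given subgroup of index N,
   then N^X has mean (2 - 1/N)^n <= N^(9k), so X >= 2n/3 = 10k has probability
   at most N^(-k). There are at most N^(E'd) maximal subgroups of index N, so
   the union bound leaves total failure probability at most
   sum_(N >= 2) N^(-2) < 1. Haar measure is avoided: for finitely many subgroups
   the elements are picked one at a time by averaging over a finite coset
   space, and compactness of G^n handles all indices at once. *)
From HB Require Import structures.
Require Import Defs.
From mathcomp Require Import all_boot all_order all_algebra.
From mathcomp Require Import finmap multiset.
From mathcomp Require Import all_classical all_reals all_analysis.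

Set Implicit Arguments.
Unset Strict Implicit.
Unset Printing Implicit Defensive.

Import Order.TTheory GRing.Theory Num.Theory.

Local Open Scope mset_scope.
Local Open Scope classical_set_scope.
Local Open Scope ring_scope.

(** * Clopen neighborhoods in compact spaces *)

(** The clopen neighborhoods of [x] are closed under finite intersection, and each point of the
    compact complement of [O] is missed by one of them; finitely many therefore suffice. *)
Lemma clopen_refine {T : topologicalType} (x : T) (O : set T) :
  compact [set: T] -> open O ->
  \bigcap_(C in [set C | clopen C /\ C x]) C `<=` O ->
  exists2 W, clopen W /\ W x & W `<=` O.
Proof.
move=> cT oO QO.
pose F := filter_from [set D : set T | clopen D /\ D x] id.
have FF : Filter F.
  apply: filter_from_filter; first by exists setT; split => //; exact: clopenT.
  by move=> A B [? ?] [? ?]; exists (A `&` B) => //; split=> //; exact: clopenI.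
have PF : ProperFilter F by apply: filter_from_proper => D [_ Dx]; exists x.
have /(iffLR (compact_near_coveringP _)) : compact (~` O).
  by apply: (subclosed_compact _ cT) => //; exact: open_closedC.
move=> /(_ _ _ setC (powerset_filter_from_filter PF))[].
  move=> y nOy; have : ~ (\bigcap_(C in [set C | clopen C /\ C x]) C) y.
    by move/QO.
  move=> /existsNP[C] /not_implyP[[[oC cC] Cx] nCy].
  exists (~` C, [set U | U `<=` C]); first split.
  - by apply: open_nbhs_nbhs; split => //; exact: closed_openC.
  - apply/near_powerset_filter_fromP; first by move=> ? ?; exact: subset_trans.
    by exists C => //; exists C.
  - by case=> i j [? /subsetC]; apply.
move=> D [DF _ [C DC]] /(_ _ DC) /subsetC2 CO.
have [W [cW Wx] WC] := DF _ DC.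
by exists W => //; exact: subset_trans WC CO.
Qed.

(* The component of a point is the intersection of its clopen neighborhoods. *)
Lemma compact_zero_dimensional {T : topologicalType} :
  compact [set: T] -> hausdorff_space T -> totally_disconnected [set: T] ->
  zero_dimensional T.
Proof.
move=> cT hT tdT x y /eqP xNy; apply: contrapT => nsep.
pose Q := \bigcap_(C in [set C : set T | clopen C /\ C x]) C.
have Qx : Q x by move=> C [].
have Qy : Q y.
  move=> C [cC Cx]; apply: contrapT => nCy; apply: nsep.
  by exists C; split.
have cQ : closed Q by apply: closed_bigI => C [[]].
suff conQ : connected Q.
  have : connected_component [set: T] x y by exists Q => //; split.
  by rewrite tdT // => yx; apply: xNy; rewrite yx.
(* [B] and its complement in [Q] are disjoint closed sets, hence separated by disjoint open sets [U]
   and [V]. A clopen neighborhood [W] of [x] inside their union meets each in a clopen set, and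
   whichever piece contains [x] contains all of [Q]. *)
move=> B [b Bb] [C oC BC] [D cD BD].
have cB : closed B by rewrite BD; exact: closedI.
have cA : closed (Q `\` B).
  have -> : Q `\` B = Q `&` ~` C.
    by rewrite BC setDIr setDv set0U setDE.
  by apply: closedI => //; exact: open_closedC.
have [N nN NA] : filter_from (set_nbhs B) closure (~` (Q `\` B)).
  apply: (compact_normal hT cT cB) => z Bz; apply: open_nbhs_nbhs.
  by split; [exact: closed_openC | case].
pose U := interior N; pose V := ~` closure N.
have oU : open U by exact: open_interior.
have oV : open V by apply: closed_openC; exact: closed_closure.
have BU : B `<=` U by move=> z Bz; exact: nN.
have AV : Q `\` B `<=` V by move=> z Az /NA.
have UV z : U z -> V z -> False.
  by move=> Uz; apply; apply: subset_closure; exact: interior_subset.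
have [|W [[oW cW] Wx] WUV] := @clopen_refine T x (U `|` V) cT (openU oU oV).
  move=> z Qz; have [Bz|nBz] := pselect (B z); first by left; exact: BU.
  by right; apply: AV.
have cWU : clopen (W `&` U).
  split; first exact: openI.
  have -> : W `&` U = W `&` ~` V.
    apply/seteqP; split=> z [Wz]; first by move=> Uz; split=> // /(UV _ Uz).
    by move=> nVz; split=> //; case: (WUV _ Wz).
  by apply: closedI => //; exact: open_closedC.
have cWV : clopen (W `&` V).
  split; first exact: openI.
  have -> : W `&` V = W `&` ~` U.
    apply/seteqP; split=> z [Wz]; first by move=> Vz; split=> // /UV; apply.
    by move=> nVz; split=> //; case: (WUV _ Wz).
  by apply: closedI => //; exact: open_closedC.
have Bsub : B `<=` Q by rewrite BC => z [].
apply/seteqP; split=> // z Qz; apply: contrapT => nBz.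
case: (WUV _ Wx) => [Ux|Vx].
- have [_ Uz] : (W `&` U) z by exact: Qz.
  by apply: (UV z) => //; apply: AV.
- have [_ Vb] : (W `&` V) b by apply: (Bsub _ Bb).
  by apply: (UV b) => //; exact: BU.
Qed.

(** * Subgroups of a profinite group and their cosets *)

Section ProfiniteSubgroups.
Variable G : profiniteGroupType.
Implicit Types (H K M U : set G) (x y : G).

Lemma subgroupP H : subgroup H <->
  H 1%g /\ forall x y, H x -> H y -> H (x^-1 * y)%g.
Proof.
split=> [sH|[H1 HVM]].
  have [H1 _] := sH; split; first by rewrite -in_setE.
  move=> x y /mem_set Hx /mem_set Hy; apply/set_mem.
  by apply: (group_closedM sH) => //; exact: (group_closedV sH).
split=> [|x y /set_mem Hx /set_mem Hy]; apply/mem_set => //.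
have HV z : H z -> H (z^-1)%g by move=> /HVM/(_ H1); rewrite mulg1.
by rewrite -[x in (x / y)%g]invgK; apply: HVM; exact: HV.
Qed.

Lemma subgroup1 H : subgroup H -> H 1%g.
Proof. by case/subgroupP. Qed.

Lemma subgroupVM H x y : subgroup H -> H x -> H y -> H (x^-1 * y)%g.
Proof. by case/subgroupP => _; apply. Qed.

Lemma subgroupV H x : subgroup H -> H x -> H (x^-1)%g.
Proof.
move=> sH Hx; rewrite -[(x^-1)%g]mulg1.
by apply: subgroupVM => //; exact: subgroup1.
Qed.

Lemma subgroupM H x y : subgroup H -> H x -> H y -> H (x * y)%g.
Proof.
move=> sH Hx; rewrite -[x in (x * _)%g]invgK.
by apply: subgroupVM => //; exact: subgroupV.
Qed.

Lemma mulgl_continuous x : continuous (fun y : G => (x * y)%g).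
Proof.
move=> y; apply: (@continuous2_cvg _ G G G _ _ (cst x) id (fun a b => (a * b)%g)).
- exact: (@profinite_mulg_continuous G (x, y)).
- exact: cvg_cst.
- exact: cvg_id.
Qed.

Lemma open_mulgl x U : open U -> open [set y | U (x * y)%g].
Proof. by move=> oU; apply: open_comp => // y _; exact: mulgl_continuous. Qed.

Lemma open_subgroupS U K : subgroup U -> open U -> subgroup K -> U `<=` K ->
  open K.
Proof.
move=> sU oU sK UK; rewrite openE => x Kx.
have : nbhs x [set y | U (x^-1 * y)%g].
  apply: open_nbhs_nbhs; split; first exact: open_mulgl.
  by rewrite /= mulVg; exact: subgroup1.
apply: filterS => y /UK Ky; have -> : y = (x * (x^-1 * y))%g by rewrite mulgA mulgV mul1g.
exact: subgroupM.
Qed.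

(* [W], the set of all [x] such that [H x] misses a clopen neighborhood of a
   point outside [H], is clopen and stable under [H] on the left; its left
   stabilizer [U] is open by compactness. *)
Lemma proper_closed_open H : proper_closed_subgroup H ->
  exists U, [/\ subgroup U, open U, U <> setT & H `<=` U].
Proof.
move=> [sH cH HT].
have [g nHg] : exists g, ~ H g.
  by apply: contrapT => /forallNP nH; apply: HT; apply/seteqP; split=> // x _;
    exact: contrapT.
have zdG := compact_zero_dimensional (@profinite_compact G)
  (@profinite_hausdorff G) (@profinite_totally_disconnected G).
have [|D [Dg [oD cD]] DH] := zero_dimensional_cvg (@profinite_hausdorff G) zdG
  (@profinite_compact G) (x := g) (t := ~` H).
  by apply: open_nbhs_nbhs; split=> //; exact: closed_openC.
pose W : set G := [set x | forall h, H h -> ~ D (h * x)%g].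
(* Tube lemma: compactness of [K] yields one neighborhood of [x] that serves every [k]. *)
have near_mul (f : G * G -> G) (K O : set G) x : continuous f -> compact K ->
    open O -> (forall k, K k -> O (f (k, x))) ->
    \forall z \near x, forall k, K k -> O (f (k, z)).
  move=> cf /compact_near_coveringP cK oO KO.
  apply: cK => k Kk; have nO : nbhs (f (k, x)) O.
    by apply: open_nbhs_nbhs; split=> //; exact: KO.
  have [[A B] /= [nA nB] AB] := cf (k, x) O nO.
  by exists (A, B) => // -[a b] /AB.
have oW : open W.
  rewrite openE => x Wx; apply: (near_mul (fun p => p.1 * p.2)%g H (~` D) x) => //.
  - exact: profinite_mulg_continuous.
  - exact: (subclosed_compact cH (@profinite_compact G)).
  - exact: closed_openC.
have cW : closed W.
  have -> : W = \bigcap_(h in H) [set x | (~` D) (h * x)%g] by [].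
  apply: closed_bigI => h _; rewrite -(setCK [set _ | _]); apply: open_closedC.
  have -> : ~` [set x | (~` D) (h * x)%g] = [set x | D (h * x)%g].
    by apply/seteqP; split=> x /=; [move/contrapT | move=> ? ].
  exact: open_mulgl.
have HW h x : H h -> W x -> W (h * x)%g.
  by move=> Hh Wx k Hk; rewrite mulgA; apply: Wx; exact: subgroupM.
have W1 : W 1%g by move=> h Hh; rewrite mulg1 => /DH.
pose U : set G := [set x | forall y, W (x * y)%g <-> W y].
have sU : subgroup U.
  apply/subgroupP; split=> [y|x y Ux Uy z]; first by rewrite mul1g.
  rewrite -mulgA -(Ux (x^-1 * (y * z))%g) mulgA mulgV mul1g; exact: Uy.
have HU : H `<=` U.
  move=> h Hh y; split; last exact: HW.
  by move=> /(HW _ _ (subgroupV sH Hh)); rewrite mulgA mulVg mul1g.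
exists U; split=> //; last first.
  (* [g] in [U] would give [W g], as [W] contains the identity; but [g] lies in [D]. *)
  move=> UT; have : U g by rewrite UT.
  move=> /(_ 1%g); rewrite mulg1 => -[_ /(_ W1)]/(_ 1%g (subgroup1 sH)).
  by rewrite mul1g.
(* Stabilizing [W] amounts to mapping both [W] and its complement into themselves; both are compact,
   so each condition persists near [x]. *)
have cV : compact W by exact: (subclosed_compact cW (@profinite_compact G)).
have cVC : compact (~` W).
  by apply: (subclosed_compact _ (@profinite_compact G)) => //; exact: open_closedC.
have cmul : continuous (fun p : G * G => (p.2 * p.1)%g).
  move=> p; apply: (@continuous2_cvg _ G G G _ _ snd fst (fun a b => (a * b)%g)).
  - exact: (@profinite_mulg_continuous G (p.2, p.1)).
  - exact: cvg_snd.
  - exact: cvg_fst.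
rewrite openE => x Ux; near=> z => y; split=> Wy.
- apply: contrapT => nWy; move: Wy.
  have : forall k, (~` W) k -> (~` W) (z * k)%g by near: z;
    apply: (near_mul _ _ _ _ cmul cVC) => [|k /= nWk]; [exact: closed_openC | rewrite Ux].
  exact.
- have : forall k, W k -> W (z * k)%g by near: z;
    apply: (near_mul _ _ _ _ cmul cV) => [//|k /=]; rewrite Ux.
  exact.
Unshelve. all: by end_near. Qed.

(** Labelling left cosets by ordinals replaces a bijection on a set of sets by a function on
    elements, the form used in the counting arguments below. *)
Lemma has_indexP U N : subgroup U -> has_index U N ->
  exists c : G -> 'I_N,
    (forall x y, c x = c y <-> U (x^-1 * y)%g) /\ (forall j, exists x, c x = j).
Proof.
move=> sU /card_set_bijP[f [fN finj fsurj]].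
pose C x : set G := [set (x * h)%g | h in U].
have CL x : left_cosets U (C x) by exists x.
have CP x y : C x = C y <-> U (x^-1 * y)%g.
  split=> [Cxy|Uxy].
    have [h Uh <-] : C x y.
      by rewrite Cxy; exists 1%g; rewrite ?mulg1 //; exact: subgroup1.
    by rewrite mulgA mulVg mul1g.
  apply/seteqP; split=> _ [h Uh <-].
    exists (y^-1 * (x * h))%g; last by rewrite mulgA mulgV mul1g.
    have -> : (y^-1 * (x * h))%g = ((x^-1 * y)^-1 * h)%g by rewrite invgM invgK mulgA.
    exact: subgroupVM.
  exists (x^-1 * (y * h))%g; last by rewrite mulgA mulgV mul1g.
  by rewrite mulgA; exact: subgroupM.
pose c x : 'I_N := Ordinal (fN _ (CL x)).
exists c; split=> [x y|j].
  rewrite -CP; split=> [/(congr1 val)/= |Cxy]; last by apply/val_inj; rewrite /= Cxy.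
  by apply: finj; exact/mem_set.
have [_ [x _ <-] fx] := fsurj _ (ltn_ord j).
by exists x; exact/val_inj.
Qed.

(** The left cosets form an open cover of a compact group; a finite subcover already contains every
    coset. *)
Lemma open_subgroup_index U : subgroup U -> open U -> exists N, has_index U N.
Proof.
move=> sU oU.
pose pG : ptopologicalType := HB.pack_for ptopologicalType (ProfiniteGroup.sort G)
  (isPointed.Build (ProfiniteGroup.sort G) 1%g).
have : @cover_compact pG [set: G] by rewrite -compact_cover; exact: profinite_compact.
move=> /(_ G [set: G] (fun x => [set y | U (x^-1 * y)%g])) [].
- by move=> x _; exact: open_mulgl.
- by move=> x _; exists x => //=; rewrite mulVg; exact: subgroup1.
move=> F _ cF; suff : finite_set (left_cosets U) by [].
apply: (sub_finite_set _ (finite_image (fun x => [set (x * h)%g | h in U])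
  (finite_fset F))).
move=> _ [x _ <-]; have [f Ff /= Ufx] := cF x I; exists f => //.
apply/seteqP; split=> _ [h Uh <-].
  exists ((f^-1 * x)^-1 * h)%g; first exact: subgroupVM.
  by rewrite invgM invgK !mulgA mulgV mul1g.
exists (f^-1 * x * h)%g; first exact: subgroupM.
by rewrite !mulgA mulgV mul1g.
Qed.

(** An overgroup [K] of [U] is a union of cosets of [U], hence determined by its finite set [im K]
    of labels. A proper overgroup with the most labels is maximal. *)
Lemma proper_open_maximal U : subgroup U -> open U -> U <> setT ->
  exists2 M, maximal_open_subgroup M & U `<=` M.
Proof.
move=> sU oU UT; have [N iU] := open_subgroup_index sU oU.
have [c [cP _]] := has_indexP sU iU.
pose im K : {set 'I_N} := [set j | `[< exists2 x, K x & c x = j >]]%SET.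
pose P k := `[< exists K, [/\ subgroup K, U `<=` K, K <> setT & #|im K| = k] >].
have exP : exists k, P k by exists #|im U|; apply/asboolP; exists U; split.
have ubP k : P k -> (k <= N)%N.
  by move=> /asboolP[K [_ _ _ <-]]; rewrite -[leqRHS]card_ord max_card.
case: (ex_maxnP exP ubP) => k /asboolP[M [sM UM MT Mk]] maxk.
exists M => //; split; last exact: (open_subgroupS sU).
split=> // K sK MK; have [->|KT] := pselect (K = setT); [by right|left].
have imMK : im M = im K.
  apply/eqP; rewrite eqEcard; apply/andP; split.
    by apply/fintype.subsetP => j; rewrite !inE => -[x Mx cx];
      exists x => //; exact: MK.
  rewrite Mk; apply: maxk; apply/asboolP; exists K; split=> //.
  exact: subset_trans UM MK.
apply/seteqP; split=> // x Kx.
have : c x \in im M by rewrite imMK !inE; exists x.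
rewrite !inE => -[y My /cP /UM Myx].
have -> : x = (y * (y^-1 * x))%g by rewrite mulgA mulgV mul1g.
exact: subgroupM.
Qed.

Lemma proper_closed_maximal H : proper_closed_subgroup H ->
  exists2 M, maximal_open_subgroup M & H `<=` M.
Proof.
move=> /proper_closed_open[U [sU oU UT HU]].
have [M mM UM] := proper_open_maximal sU oU UT.
by exists M => //; exact: subset_trans UM.
Qed.

Lemma has_index_gt1 M N : subgroup M -> M <> setT -> has_index M N -> (1 < N)%N.
Proof.
move=> sM MT iM; have [c [cP csurj]] := has_indexP sM iM.
case: N iM c cP csurj => [|[|//]] _ c cP _; first by case: (c 1%g).
case: MT; apply/seteqP; split=> // x _.
by have /cP : c 1%g = c x; [rewrite !ord1 | rewrite invg1 mul1g].
Qed.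

(** * Random choice against finitely many subgroups *)

(* Averaging over coset representatives [rep u] of the intersection of all the
   [M i] replaces averaging over Haar measure: translates by coset
   representatives of [M i] show that at most one in [N i] lies in [M i]. *)
Lemma exists_le_average (R : realFieldType) (I : finType) (M : I -> set G)
    (N : I -> nat) (b : I -> R) :
  (forall i, subgroup (M i)) -> (forall i, has_index (M i) (N i)) ->
  (forall i, 0 <= b i) ->
  exists x, \sum_i b i * (x \in M i)%:R <= \sum_i b i / (N i)%:R.
Proof.
move=> sM iM b_ge0.
pose c i := projT1 (cid (has_indexP (sM i) (iM i))).
have cP i x y : c i x = c i y <-> M i (x^-1 * y)%g.
  by rewrite /c; case: cid => f [].
have csurj i j : exists x, c i x = j by rewrite /c; case: cid => f [].
pose t i j := projT1 (cid (csurj i j)).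
have tP i j : c i (t i j) = j by rewrite /t; case: cid.
pose phi x : {dffun forall i, 'I_(N i)} := [ffun i => c i x].
have phiP x y : phi x = phi y <-> forall i, M i (x^-1 * y)%g.
  split=> [/ffunP E i|E]; first by have := E i; rewrite !ffunE => /cP.
  by apply/ffunP => i; rewrite !ffunE; exact/cP.
pose im := [set u | `[< exists x, phi x = u >]]%SET.
pose rep u := xget 1%g [set x | phi x = u].
have repK u : u \in im -> phi (rep u) = u.
  by rewrite !inE => -[x xu]; rewrite /rep; case: xgetP => [y _ //|/(_ x)].
have phi_im x : phi x \in im by rewrite !inE; exists x.
pose A i := [set u in im | rep u \in M i]%SET.
have cardA i : (N i * #|A i| <= #|im|)%N.
  pose f (p : 'I_(N i) * {dffun forall i, 'I_(N i)}) := phi (t i p.1 * rep p.2)%g.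
  rewrite -[N i]card_ord -cardsT -cardsX -(@card_in_imset _ _ f).
    apply: subset_leq_card; apply/fintype.subsetP => _ /imsetP[p _ ->].
    exact: phi_im.
  move=> [j u] [k v]; rewrite /f /=.
  move=> /setXP[_ /setIdP[u_im Mu]] /setXP[_ /setIdP[v_im Mv]].
  move/phiP => E.
  have jk : j = k.
    rewrite -(tP i j) -(tP i k); apply/cP.
    have := subgroupM (sM i) (subgroupM (sM i) (set_mem Mu) (E i))
      (subgroupV (sM i) (set_mem Mv)).
    by rewrite invgM !mulgA mulgV mul1g -[(_ * rep v / _)%g]mulgA mulgV mulg1.
  rewrite -{}jk in E *; congr pair; rewrite -(repK u) // -(repK v) //.
  apply/phiP => i'; have := E i'.
  by rewrite invgM -mulgA [X in (_ * X)%g]mulgA mulVg mul1g.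
apply: contrapT => /forallNP nle.
have im1 : (0 < #|im|)%N by rewrite (cardD1 (phi 1%g)) phi_im.
pose avg := \sum_i b i / (N i)%:R.
(* After exchanging the sums, [b i] is counted at most [#|A i|] times, which [cardA] bounds by
   [#|im| / N i]. *)
have : \sum_(u in im) \sum_i b i * (rep u \in M i)%:R <= \sum_(u in im) avg.
  rewrite exchange_big sumr_const /avg -sumrMnl; apply: ler_sum => i _.
  rewrite -mulr_sumr -mulrnAr; apply: ler_wpM2l => //.
  have N0 : 0 < (N i)%:R :> R by rewrite ltr0n; case: (N i) (c i 1%g) => // -[].
  rewrite -mulr_natr mulrC ler_pdivlMr //.
  rewrite -natr_sum -natrM ler_nat mulnC; apply: leq_trans (cardA i).
  by rewrite leq_mul2l -sum1dep_card big_mkcondr /= leqnn orbT.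
apply/negP; rewrite -ltNge.
apply: ltr_sum => [|u _]; last by rewrite ltNge; apply/negP; exact: nle.
by apply/hasP; exists (phi 1%g); rewrite ?mem_index_enum.
Qed.

Lemma subr2V_ge0 (R : realFieldType) (N : nat) : (0 < N)%N ->
  0 <= 2 - N%:R^-1 :> R.
Proof.
move=> N_gt0; rewrite subr_ge0 (@le_trans _ _ 1) ?ler1n //.
by rewrite invf_le1 ?ltr0n ?ler1n.
Qed.

(** A uniform element multiplies the [i]-th term by [N i] with probability [1 / N i] and by 1
    otherwise, on average by [2 - 1 / N i]. Choosing elements one at a time keeps the weighted sum
    at most its mean. *)
Lemma exists_le_moment (R : realFieldType) (I : finType) (M : I -> set G)
    (N : I -> nat) (w : I -> R) n :
  (forall i, subgroup (M i)) -> (forall i, has_index (M i) (N i)) ->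
  (forall i, 0 < N i)%N -> (forall i, 0 <= w i) ->
  exists2 a : seq G, size a = n &
    \sum_i w i * (N i)%:R ^+ count [in M i] a <=
    \sum_i w i * (2 - (N i)%:R^-1) ^+ n.
Proof.
move=> sM iM N_gt0; elim: n w => [|n IH] w w_ge0.
  by exists [::] => //; apply: ler_sum => i _; rewrite !expr0.
have N_ge1 i : 1 <= (N i)%:R :> R by rewrite ler1n.
have N_neq0 i : (N i)%:R != 0 :> R by rewrite pnatr_eq0 -lt0n.
have q_ge0 i : 0 <= 2 - (N i)%:R^-1 :> R.
  exact: subr2V_ge0.
(* The new weights absorb the mean factor of the element chosen last. *)
have [a sa le_a] := IH (fun i => w i * (2 - (N i)%:R^-1))
  (fun i => mulr_ge0 (w_ge0 i) (q_ge0 i)).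
(* The increase of the [i]-th term when the new element falls in [M i]. *)
pose b i := w i * (N i)%:R ^+ count [in M i] a * ((N i)%:R - 1).
have [x le_x] : exists x, \sum_i b i * (x \in M i)%:R <= \sum_i b i / (N i)%:R.
  apply: exists_le_average => // i; rewrite !mulr_ge0 ?exprn_ge0 //.
  by rewrite subr_ge0.
exists (x :: a); first by rewrite /= sa.
under [leRHS]eq_bigr => i _ do rewrite exprS mulrA.
apply: le_trans le_a.
pose f i := w i * (N i)%:R ^+ count [in M i] a.
have -> : \sum_i w i * (N i)%:R ^+ count [in M i] (x :: a) =
    \sum_i f i + \sum_i b i * (x \in M i)%:R.
  rewrite -big_split; apply: eq_bigr => i _ /=; rewrite /f /b.
  case: (x \in M i); last by rewrite add0n mulr0 addr0.
  by rewrite add1n exprS mulr1 mulrBr mulr1 addrC subrK -mulrA [_ * (N i)%:R]mulrC.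
have -> : \sum_i w i * (2 - (N i)%:R^-1) * (N i)%:R ^+ count [in M i] a =
    \sum_i f i + \sum_i b i / (N i)%:R.
  rewrite -big_split; apply: eq_bigr => i _ /=; rewrite /f /b.
  rewrite mulrAC -[in RHS]mulrA -[X in _ = X + _]mulr1 -mulrDr; congr (_ * _).
  by rewrite mulrBl divff // mul1r addrA.
by rewrite lerD2l.
Qed.

(** This is [(2 - 1 / N) ^ 5 <= N ^ 3] cleared of denominators. It is nearly sharp at [N = 2], where
    it reads [243 <= 256]; from [N = 4] on, [2 ^ 5 <= 4 ^ 3] suffices. *)
Lemma expn5_le_expn8 (N : nat) : (1 < N)%N -> ((2 * N - 1) ^ 5 <= N ^ 8)%N.
Proof.
case: (ltnP N 4) => [|N_ge4 _].
  by case: N => [|[|[|[|N]]]] // _ _; vm_compute.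
apply: (@leq_trans ((2 * N) ^ 5)); first by rewrite leq_exp2r // leq_subr.
rewrite expnMn -[8%N]/(5 + 3)%N expnD mulnC leq_mul2l; apply/orP; right.
by apply: (@leq_trans (4 ^ 3)) => //; rewrite leq_exp2r.
Qed.

(** For [15 * k] draws this bounds the mean by [N ^ (9 * k)], a factor [N ^ k] below the threshold
    value [N ^ (10 * k)]. *)
Lemma expr5_le_expr3 (R : realFieldType) (N : nat) : (1 < N)%N ->
  (2 - N%:R^-1) ^+ 5 <= N%:R ^+ 3 :> R.
Proof.
move=> N_gt1; have N_gt0 : 0 < N%:R :> R by rewrite ltr0n ltnW.
have N2 : (1 <= 2 * N)%N by rewrite muln_gt0 /= ltnW.
have -> : 2 - N%:R^-1 = (2 * N - 1)%:R / N%:R :> R.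
  by rewrite natrB // mulrBl mul1r natrM mulfK ?gt_eqF.
rewrite exprMn exprVn ler_pdivrMr ?exprn_gt0 // -exprD -!natrX ler_nat.
exact: expn5_le_expn8.
Qed.

(** Markov's inequality and the union bound: with weights [N i ^- (10 * k)], a subgroup containing
    [10 * k] of the elements alone contributes at least 1, while the total is at most the sum of the
    [N i ^- k]. *)
Lemma exists_few_in (R : realFieldType) (I : finType) (M : I -> set G)
    (N : I -> nat) k :
  (forall i, subgroup (M i)) -> (forall i, has_index (M i) (N i)) ->
  (forall i, 1 < N i)%N -> \sum_i (N i)%:R ^- k < 1 :> R ->
  exists2 a : seq G, size a = (15 * k)%N &
    forall i, (count [in M i] a < 10 * k)%N.
Proof.
move=> sM iM N_gt1 sum_lt1.
have N_gt0 i : (0 < N i)%N by exact: ltnW.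
have NR_gt0 i : 0 < (N i)%:R :> R by rewrite ltr0n.
pose w i : R := (N i)%:R ^- (10 * k).
have w_ge0 i : 0 <= w i by rewrite invr_ge0 exprn_ge0.
have [a sa le_a] := exists_le_moment (15 * k)%N sM iM N_gt0 w_ge0.
exists a => // i; rewrite ltnNge; apply/negP => many.
suff : 1 < 1 :> R by rewrite ltxx.
apply: le_lt_trans sum_lt1; apply: le_trans (le_trans le_a _).
  rewrite (bigD1 i) //= -[leLHS]addr0; apply: lerD.
    by rewrite /w mulrC ler_pdivlMr ?exprn_gt0 // mul1r ler_weXn2l // ler1n.
  by apply: sumr_ge0 => j _; rewrite mulr_ge0 ?exprn_ge0.
apply: ler_sum => j _; rewrite /w mulrC ler_pdivrMr ?exprn_gt0 //.
rewrite -[15%N]/(5 * 3)%N -mulnA exprM.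
apply: (@le_trans _ _ (((N j)%:R ^+ 3) ^+ (3 * k))).
  apply: lerXn2r; rewrite ?nnegrE ?exprn_ge0 ?expr5_le_expr3 //.
  exact: subr2V_ge0.
rewrite -exprM -exprVn -[10%N]/(1 + 9)%N mulnDl mul1n exprD mulrA -exprMn.
by rewrite mulVf ?gt_eqF // expr1n mul1r mulnA.
Qed.

(** Telescoping: each term is at most [1 / (j + 1) - 1 / (j + 2)]. *)
Lemma sum_invr_sqr_lt1 (R : realFieldType) B :
  \sum_(j < B) (j.+2%:R ^- 2 : R) < 1.
Proof.
suff : \sum_(j < B) (j.+2%:R ^- 2 : R) <= 1 - B.+1%:R^-1.
  by move=> /le_lt_trans; apply; rewrite gtrBl invr_gt0.
elim: B => [|B IH]; first by rewrite big_ord0 invr1 subrr.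
rewrite big_ord_recr /=; apply: le_trans (lerD IH (lexx _)) _.
set a : R := B.+1%:R; set c : R := B.+2%:R.
have a_gt0 : 0 < a by rewrite ltr0n.
have c_gt0 : 0 < c by rewrite ltr0n.
have ac : a <= c by rewrite ler_nat.
have e : a^-1 - c^-1 = (a * c)^-1.
  have -> : a^-1 - c^-1 = (c - a) / (a * c).
    rewrite invfM mulrBl [c * _]mulrCA divff ?gt_eqF // mulr1.
    by rewrite mulrA divff ?gt_eqF // mul1r.
  by rewrite /c -natr1 addrAC subrr add0r mul1r.
rewrite -addrA lerD2l lerNr opprD opprK lerBrDr -lerBrDl e.
by rewrite lef_pV2 ?posrE ?mulr_gt0 ?exprn_gt0 // expr2 ler_pM2r.
Qed.

(** At most [N ^ (m * d)] subgroups of index [N] contribute [N ^- ((m + 2) * d)] each; the summand 2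
    leaves [N ^- (2 * d)], at most [N ^- 2], whose sum over [N >= 2] stays below 1. *)
Lemma exists_few_in_upto (m d B : nat) (L : nat -> seq (set G)) :
  (0 < d)%N ->
  (forall N M, M \in L N -> subgroup M /\ has_index M N) ->
  (forall N, (1 < N)%N -> (size (L N) <= N ^ (m * d))%N) ->
  exists2 a : seq G, size a = (15 * ((m + 2) * d))%N &
    forall N M, (1 < N < B.+2)%N -> M \in L N ->
      (count [in M] a < 10 * ((m + 2) * d))%N.
Proof.
move=> d_gt0 LP sizeL.
(* The shift by 2 makes [j < B] run through the indices from 2 to [B + 1]. *)
pose I := {j : 'I_B & 'I_(size (L j.+2))}.
pose M (i : I) := nth set0 (L (tag i).+2) (tagged i).
pose N (i : I) := (tag i).+2.
have ML i : M i \in L (N i) by exact: mem_nth.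
have [i||||a sa aP] := @exists_few_in rat I M N ((m + 2) * d).
- by case: (LP _ _ (ML i)).
- by move=> i; case: (LP _ _ (ML i)).
- by [].
- apply: le_lt_trans (sum_invr_sqr_lt1 _ B).
  have -> : \sum_i (N i)%:R ^- ((m + 2) * d) =
      \sum_(j < B) \sum_(l < size (L j.+2)) j.+2%:R ^- ((m + 2) * d) :> rat.
    by rewrite sig_big_dep.
  apply: ler_sum => j _; rewrite sumr_const card_ord -[_ *+ size _]mulr_natl.
  have j_gt0 : 0 < j.+2%:R :> rat by rewrite ltr0n.
  rewrite ler_pdivrMr ?exprn_gt0 //; apply: (@le_trans _ _ (j.+2%:R ^+ (m * d))).
    by rewrite -natrX ler_nat sizeL.
  rewrite mulnDl exprD mulrCA ler_peMr ?exprn_ge0 //.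
  rewrite mulrC ler_pdivlMr ?exprn_gt0 // mul1r ler_weXn2l ?ler1n //.
  by rewrite leq_pmulr.
exists a => // n K; case: n => [|[|n]] //; rewrite !ltnS /= => n_lt KL.
have n_size : (index K (L (Ordinal n_lt).+2) < size (L n.+2))%N by rewrite index_mem.
have := aP (existT (fun j : 'I_B => 'I_(size (L j.+2))) (Ordinal n_lt) (Ordinal n_size)).
by rewrite /M /= nth_index.
Qed.

(** * Passage to all indices by compactness *)

(* A cluster point in [G^n] of tuples that are good for the subgroups of
   index less than [B] is good for all of them, goodness being closed. *)
Lemma exists_few_in_all n k (S : nat -> set (set G)) :
  (forall N M, S N M -> open M) ->
  (forall B, exists2 a : seq G, size a = n &
    forall N M, (N < B)%N -> S N M -> (count [in M] a < k)%N) ->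
  exists2 a : seq G, size a = n &
    forall N M, S N M -> (count [in M] a < k)%N.
Proof.
move=> openS good.
pose s B := sval (cid2 (good B)).
pose X := prod_topology (fun _ : 'I_n => G : topologicalType).
pose u (B : nat) : X := fun i => nth 1%g (s B) i.
pose num M (a : X) := count [in M] [seq a i | i <- enum 'I_n].
have numu B N M : (N < B)%N -> S N M -> (num M (u B) < k)%N.
  rewrite /num; move=> NB SM.
  have -> : [seq u B i | i <- enum 'I_n] = s B.
    rewrite /u /s; case: cid2 => /= a sa _.
    rewrite -[in RHS](mkseq_nth 1%g a) sa /mkseq -val_enum_ord -map_comp.
    exact: eq_map.
  by rewrite /s; case: cid2 => /= a _ /(_ N M NB SM).
have [p [_ pcl]] : exists p : X,
    ([set f : X | forall i, setT (f i)] `&` cluster (u @ \oo)) p.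
  apply: (@tychonoff 'I_n (fun _ => G) (fun _ => setT)) => //.
    by move=> _; exact: profinite_compact.
  by exists 0%N.
exists [seq p i | i <- enum 'I_n]; first by rewrite size_map size_enum_ord.
move=> N M SM; rewrite -/(num M p) ltnNge; apply/negP => kp.
(* Near [p], every coordinate of [p] in the open set [M] stays in [M], so the count for [M] cannot
   drop; a nearby tuple with fewer than [k] entries in [M] then bounds the count at [p]. *)
have nbp : nbhs p [set a : X | forall i, M (p i) -> M (a i)].
  apply: (@filter_forall X _ (fun i (a : X) => M (p i) -> M (a i)) (nbhs p)) => i.
  have [Mpi|nMpi] := pselect (M (p i)); last exact: nearW.
  have : nbhs p (@proj _ (fun _ => G) i @^-1` M).
    apply: proj_continuous; apply: open_nbhs_nbhs; split=> //; exact: openS SM.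
  by apply: (@filterS _ _ (nbhs_filter p)) => a + _.
have ev : (u @ \oo) [set a | (num M a < k)%N].
  by exists N.+1 => // B /= NB; exact: numu SM.
have [q [qk pq]] := pcl _ _ ev nbp.
move: qk; rewrite /= ltnNge; apply/negP; rewrite negbK (leq_trans kp) //.
rewrite /num !count_map; apply: sub_count => i /=.
by rewrite !in_setE; exact: pq.
Qed.

(** * Rank, and listing the maximal open subgroups *)

(** A least cardinality exists, so [rank] is not the default of [xget]. *)
Lemma rank_generated : topologically_finitely_generated G ->
  generated_by_card G (rank G).
Proof.
move=> fg; rewrite /rank; case: xgetP => [n -> [] //|nomin].
have exP : exists n, `[< generated_by_card G n >].
  by case: fg => n gn; exists n; exact/asboolP.
case: (ex_minnP exP) => n /asboolP gn minn.
by case: (nomin n); split=> // k gk; apply: minn; exact/asboolP.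
Qed.

(** In rank 0 the empty set generates a dense subgroup, which lies in [H]; the open complement of
    [H] must then be empty. *)
Lemma rank0_closed_subgroup H : topologically_finitely_generated G ->
  rank G = 0%N -> subgroup H -> closed H -> H = setT.
Proof.
move=> /rank_generated + r0 sH cH; rewrite r0 => -[S [S0 densS]].
move: S0; rewrite II0 card_eq0 => /eqP S0; rewrite {}S0 in densS.
apply: contrapT => HT.
have [x nHx] : exists x, ~ H x.
  by apply: contrapT => /forallNP nH; apply: HT; apply/seteqP; split=> // x _;
    exact: contrapT.
have [y [nHy]] := densS (~` H) (ex_intro _ x nHx) (closed_openC cH).
by move/(_ H (conj sH (@sub0set _ _))).
Qed.

Lemma rank0_trivial : topologically_finitely_generated G ->
  rank G = 0%N -> [set: G] = [set 1%g].
Proof.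
move=> fg r0; apply/esym/(rank0_closed_subgroup fg r0).
  by apply/subgroupP; split=> // x y -> ->; rewrite mulVg.
exact: (accessible_closed_set1 (hausdorff_accessible (@profinite_hausdorff G))).
Qed.

(** A finite bound excludes the value [+oo] of [counting], so the subgroups can be listed; the real
    exponent is rounded up to a natural one. *)
Lemma maximal_open_enum (R : realType) (E : R) (m N : nat) :
  E <= m%:R -> (num_maximal_open G R N <= (N%:R `^ E)%:E)%E -> (0 < N)%N ->
  exists2 L : seq (set G),
    forall M, M \in L <-> maximal_open_subgroup M /\ has_index M N &
    (size L <= N ^ m)%N.
Proof.
rewrite /num_maximal_open /counting; set S := [set M | _] => Em.
case: asboolP => // finS; rewrite lee_fin => le_N N_gt0.
exists (fset_set S); first by move=> M; rewrite in_fset_set // in_setE.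
rewrite -(@ler_nat R) (le_trans le_N) // natrX -powR_mulrn //.
by apply: ler_powR => //; rewrite ler1n.
Qed.

End ProfiniteSubgroups.

(** * Choice of the constant and the detection bound *)

Theorem theorem5p1 (R : realType) (delta E' : R)
    (delta_gt0 : 0 < delta) (delta_lt : delta < 1 / 3) (E'_gt0 : 0 < E') :
  exists C : R,
    forall fam : set profiniteGroupType,
      (forall G : profiniteGroupType, fam G ->
         topologically_finitely_generated G) ->
      uniformly_PMSG E' fam ->
      forall G : profiniteGroupType, fam G ->
        exists A : {mset G},
          [/\ [set: G] <> [set 1%g] -> A <> mset0,
              (size A)%:R <= C * (rank G)%:R
            & (delta%:E <= detection_prob R A)%E].
Proof.
(* [m] is a natural number above [E'], and the constant is the sample size [15 * ((m + 2) * d)] per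
   unit of rank. *)
pose m := Num.bound E'; exists (15 * (m + 2))%:R => fam fg pmsg G famG.
have [r0|r_gt0] := posnP (rank G).
  (* In rank 0 the size bound forces the empty multiset; there is no proper closed subgroup, so the
     infimum runs over the empty set. *)
  exists mset0; split.
  - by move/(_ (rank0_trivial (fg _ famG) r0)).
  - by rewrite r0 mulr0 size_mset0.
  - apply: le_ereal_inf_tmp => _ [H [sH cH HT] <-].
    by case: HT; exact: (rank0_closed_subgroup (fg _ famG) r0).
set d := rank G in r_gt0 *.
have Em : E' * d%:R <= (m * d)%:R.
  by rewrite natrM ler_wpM2r // ltW // archi_boundP // ltW.
pose S N M := maximal_open_subgroup M /\ @has_index G M N.
pose k := (10 * ((m + 2) * d))%N.
have [a sa aP] : exists2 a : seq G, size a = (15 * ((m + 2) * d))%N &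
    forall N M, S N M -> (count [in M] a < k)%N.
  apply: exists_few_in_all => [N M [[]] //|B].
  have enumS N : exists L : seq (set G), (0 < N)%N ->
      (forall M, M \in L <-> S N M) /\ (size L <= N ^ (m * d))%N.
    have [->|N_gt0] := posnP N; first by exists [::].
    have [L LP sL] := maximal_open_enum Em (pmsg G famG N) N_gt0.
    by exists L.
  have [L LP] := choice enumS.
  (* [L 0] is unconstrained, hence its replacement by the empty list. *)
  have [||a sa aP] := @exists_few_in_upto G m d B
    (fun N => if (0 < N)%N then L N else [::]) r_gt0.
  - move=> [|N] M //= ML; have [LP1 _] := LP N.+1 isT.
    by have [[[sM _ _] _] iM] := (LP1 M).1 ML.
  - by move=> [|N] // _; have [_] := LP N.+1 isT.
  exists a => // N M NB SM; have [[[sM MT _] _] iM] := SM.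
  have N_gt1 := has_index_gt1 sM MT iM.
  apply: (aP N); first by rewrite N_gt1 ltnS leqW // ltnW.
  have N_gt0 := ltnW N_gt1; have [LPN _] := LP N N_gt0.
  by rewrite N_gt0; apply/LPN.
have Asa := perm_eq_seq_mset a.
have k_gt0 : (0 < (m + 2) * d)%N by rewrite muln_gt0 addn2.
exists (seq_mset a); split.
- move=> _ a0; have := k_gt0.
  by rewrite -(@ltn_pmul2l 15) // muln0 -sa -(perm_size Asa) a0 size_mset0.
- by rewrite (perm_size Asa) sa mulnA natrM lexx.
- apply: le_ereal_inf_tmp => _ [H pH <-]; rewrite lee_fin.
  have [M mM HM] := proper_closed_maximal pH; have [[sM MT _] oM] := mM.
  have [N iM] := open_subgroup_index sM oM.
  rewrite (perm_size Asa) (permP Asa) sa.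
  have few : (count [in H] a <= k)%N.
    apply/ltnW/leq_ltn_trans/(aP N M) => //; apply: sub_count => x.
    by rewrite !in_setE; exact: HM.
  (* The threshold is [10 / 15 = 2 / 3] of the sample, leaving a detection probability of at least
     [1 / 3], above [delta]. *)
  have kE : k%:R / (15 * ((m + 2) * d))%:R = 2 / 3 :> R.
    rewrite /k -[10%N]/(2 * 5)%N -[15%N]/(3 * 5)%N -!mulnA.
    rewrite !(natrM _ _ (5 * _)) -mulf_div divff ?mulr1 //.
    by rewrite pnatr_eq0 -lt0n muln_gt0 k_gt0.
  rewrite lerBrDr (@le_trans _ _ (1 / 3 + 2 / 3)) //.
    apply: lerD; first exact: ltW.
    by rewrite -kE ler_pM2r ?ler_nat // invr_gt0 ltr0n muln_gt0.
  by rewrite -mulrDl divff // pnatr_eq0.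
Qed.
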